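(* Let $\mathscr A^{\mathrm{sf}}$ be a semi-free $A_\infty$-category and let $\mathscr B,\mathscr C$ be two strictly unital $A_\infty$-categories. Given a strict strictly unital $A_\infty$-functor $F:\mathscr A^{\mathrm{sf}}\to\mathscr B$ and a strict strictly unital quasi-equivalence $G:\mathscr C\to\mathscr B$ which is surjective on the morphisms, there exists a (not necessarily unique) strict strictly unital $A_\infty$-functor $\tilde F:\mathscr A^{\mathrm{sf}}\to\mathscr C$ with $G\cdot\tilde F=F$, i.e. making the triangle commutative in $A_\infty\mathrm{Cat}_{\mathrm{strict}}$.
   Context: $R$ is a commutative ring; categories are small. A graded $R$-linear quiver has a set of objects and graded $R$-modules $\mathrm{Hom}(x,y)$; a DG quiver also has differentials $d$ of degree $1$ on each $\mathrm{Hom}(x,y)$. A non unital $A_\infty$-category $\mathscr A$ is a graded $R$-linear quiver with $R$-linear maps $m^n_{\mathscr A}:\mathrm{Hom}(x_{n-1},x_n)\otimes\cdots\otimes\mathrm{Hom}(x_0,x_1)\to\mathrm{Hom}(x_0,x_n)[2-n]$ ($n\ge1$) such that $\sum_{m=1}^n\sum_{d=0}^{n-m}(-1)^{\dagger_d}m^{n-m+1}(f_n,\dots,f_{d+m+1},m^m(f_{d+m},\dots,f_{d+1}),f_d,\dots,f_1)=0$, with $\dagger_d=\sum_{i\le d}\deg f_i-d$. Its underlying DG quiver is $|\mathscr A|=(\mathscr A,m^1)$. It is strictly unital if every $x$ has a closed degree $0$ morphism $1_x$ with $m^2(f,1_x)=f=(-1)^{\deg f}m^2(1_y,f)$ for $f:x\to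 y$, and $m^n(\dots,1_x,\dots)=0$ for $n\ge3$. A strict $A_\infty$-functor $F:\mathscr A\to\mathscr B$ is a map $F^0$ on objects and degree $0$ $R$-linear maps $F^1:\mathrm{Hom}_{\mathscr A}(x,y)\to\mathrm{Hom}_{\mathscr B}(F^0x,F^0y)$ commuting with all $m^n$; it is strictly unital if $F^1(1_x)=1_{F^0x}$. $A_\infty\mathrm{Cat}_{\mathrm{strict}}$ is the category of strictly unital $A_\infty$-categories and strict strictly unital $A_\infty$-functors. $F$ is a quasi-equivalence if every $F^1$ is a quasi-isomorphism for $m^1$ and the induced functor $H^0(F)$ is essentially surjective. $F$ is surjective on the morphisms if every $F^1:\mathrm{Hom}_{\mathscr A}(x,y)\to\mathrm{Hom}_{\mathscr B}(F^0x,F^0y)$ is surjective. Free $A_\infty$-categories. The functor $\mathscr A\mapsto|\mathscr A|$ from non unital $A_\infty$-categories with strict functors to DG quivers has a left adjoint $Q\mapsto\mathfrak F(Q)$ (the free $A_\infty$-category; same objects, morphisms spanned by planar rooted trees all of whose internal vertices have at least two inputs, with leaves labelled by composable morphisms of $Q$, operations $m^{n\ge2}$ given by grafting). An $A_\infty$-ideal of $\mathscr A$ is a DG subquiver $I$ of $|\mathscr A|$ such that every $m^n$ with one input in $I$ lies in $I$; $\mathscr A/I$ has the quotient Hom modules and induced operations. Semi-free. $\mathrm{disc}(\mathscr A)$ has the objects of $\mathscr A$, $\mathrm{Hom}(x,x)=R\cdot1_x$ free of rank one, $\mathrm{Hom}(x,y)=0$ for $x\ne y$, zero differential. A strictly unital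 $\mathscr A$ is semi-free if it is the union of an increasing sequence of strictly unital $A_\infty$-subcategories $\mathscr A_0\subset\mathscr A_1\subset\cdots$ with the same objects, with DG quivers $|\mathscr A_0|\subset Q_1\subset|\mathscr A_1|\subset Q_2\subset\cdots\subset|\mathscr A|$, such that: (1) $\mathscr A_0$ is the isomorphic image of $\mathrm{disc}(\mathscr A)$ under a strict functor that is bijective on objects; (2) for $n\ge1$, $Q_n\simeq|\mathscr A_{n-1}|\oplus B_n$ as graded quivers for some graded quiver $B_n$; (3) for $n\ge1$, compatibly with $Q_n\subset|\mathscr A_n|$, $\mathscr A_n\simeq\mathfrak F(Q_n)/I_n$ where $I_n$ is the ideal generated by the elements $m^k_{\mathfrak F(Q_n)}(f_k,\dots,f_1)-m^k_{\mathscr A_{n-1}}(f_k,\dots,f_1)$ ($k\ge2$, $f_i\in\mathscr A_{n-1}$) and by the relations saying that the $1_x$ of $\mathscr A_0$ are strict units; (4) $Q_n/|\mathscr A_{n-1}|$ has zero differential and free Hom $R$-modules.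
   Formalization: Assumes in addition that every object F(a) equals G(c) for some object c of C: a quasi-equivalence surjective on morphisms need only be essentially surjective on objects, so the claim fails without it; the condition is implied by G·F̃ = F. *)

(* Defs.v *)
From HB Require Import structures.
From mathcomp Require Import all_boot all_order all_algebra.
From mathcomp Require Import generic_quotient ring_quotient boolp zify.

Set Implicit Arguments.
Unset Strict Implicit.
Unset Printing Implicit Defensive.

Import GRing.Theory.
Local Open Scope ring_scope.
Local Open Scope quotient_scope.

Section Submodules.
Variables (R : comPzRingType) (V : lmodType R).

Definition submod (S : submodClosed V) : Type := {x : V | x \in S}.
HB.instance Definition _ S := SubChoice.on (submod S).
HB.instance Definition _ S := [SubChoice_isSubLmodule of submod S by <:].

Lemma submod_val_linear (S : submodClosed V) :
  linear (fun f : submod S => \val f).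
Proof. by move=> a u v; rewrite linearP. Qed.

Lemma submodN (S : submodClosed V) (x : V) : x \in S -> - x \in S.
Proof. by move=> Sx; rewrite -scaleN1r rpredZ. Qed.

Lemma submodB (S : submodClosed V) (x y : V) :
  x \in S -> y \in S -> x - y \in S.
Proof. by move=> Sx Sy; rewrite rpredD ?submodN. Qed.

(* The library quotients a [zmodType] by a [zmodClosed] predicate; what is
   missing is the scalar multiplication on the quotient by a submodule. *)
Definition zmod_of (S : submodClosed V) : {pred V} := fun x => x \in S.
Lemma zmod_of_closed S : zmod_closed (zmod_of S).
Proof. by split=> [|x y Sx Sy]; [exact: rpred0 | exact: submodB]. Qed.
HB.instance Definition _ S := GRing.isZmodClosed.Build V (zmod_of S)
  (zmod_of_closed S).

Definition quotmod (S : submodClosed V) : Type := Quotient.quot (zmod_of S).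
HB.instance Definition _ S := GRing.Zmodule.on (quotmod S).

Definition qpi (S : submodClosed V) (x : V) : quotmod S :=
  \pi_(Quotient.quot (zmod_of S)) x.
Definition qrepr (S : submodClosed V) (c : quotmod S) : V :=
  repr (c : Quotient.quot (zmod_of S)).

Lemma qreprK S : cancel (@qrepr S) (@qpi S).
Proof. by move=> c; apply: reprK. Qed.
Lemma qpi_eq S x y : (qpi S x = qpi S y) <-> (x - y \in S).
Proof.
rewrite /qpi; split=> [/eqP|h]; first by rewrite -Quotient.idealrBE.
by apply/eqP; rewrite -Quotient.idealrBE.
Qed.
Lemma qpiK S x : qrepr (qpi S x) - x \in S.
Proof. by apply/qpi_eq; rewrite qreprK. Qed.
Lemma qpiD S x y : qpi S (x + y) = qpi S x + qpi S y.
Proof. exact: (Quotient.pi_add (zmod_of S)). Qed.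

Definition qscale S (a : R) (c : quotmod S) : quotmod S := qpi S (a *: qrepr c).

Lemma qpiZ S a x : qpi S (a *: x) = qscale a (qpi S x).
Proof.
by apply/qpi_eq; rewrite -scalerBr rpredZ // -opprB submodN // qpiK.
Qed.
Lemma qscaleA S a b c : @qscale S a (qscale b c) = qscale (a * b) c.
Proof. by rewrite -[c]qreprK -!qpiZ scalerA. Qed.
Lemma qscale1 S : left_id 1 (@qscale S).
Proof. by move=> c; rewrite -[c]qreprK -!qpiZ scale1r. Qed.
Lemma qscaleDr S : right_distributive (@qscale S) +%R.
Proof.
by move=> a c c'; rewrite -[c]qreprK -[c']qreprK -qpiD -!qpiZ -qpiD scalerDr.
Qed.
Lemma qscaleDl S c : {morph @qscale S ^~ c : a b / a + b}.
Proof. by move=> a b; rewrite -[c]qreprK -!qpiZ -qpiD scalerDl. Qed.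
HB.instance Definition _ S := GRing.Zmodule_isLmodule.Build R (quotmod S)
  (@qscaleA S) (@qscale1 S) (@qscaleDr S) (@qscaleDl S).

Lemma qpi_linear S : linear (qpi S : V -> quotmod S).
Proof. by move=> a x y; rewrite qpiD qpiZ. Qed.

End Submodules.

Lemma linear_sub (R : comPzRingType) (U V : lmodType R) (f : U -> V) :
  linear f -> forall u v, f (u - v) = f u - f v.
Proof. by move=> h u v; rewrite addrC -scaleN1r h scaleN1r addrC. Qed.

Definition free_module (R : comPzRingType) (M : lmodType R) : Prop :=
  exists (I : Type) (b : I -> M),
    (forall n (i : 'I_n -> I) (a : 'I_n -> R), injective i ->
       \sum_k a k *: b (i k) = 0 -> forall k, a k = 0)
    /\ (forall v : M, exists n (i : 'I_n -> I) (a : 'I_n -> R),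
       v = \sum_k a k *: b (i k)).

(* [h x y d] is the degree [d] part of Hom(x, y). *)
Record gquiver (R : comPzRingType) (O : Type) := GQuiver {
  ghom :> O -> O -> int -> lmodType R }.

(* [pcons f_n (.. (pcons f_1 (pnil x_0)))] is a composable sequence
   (f_n, .., f_1) of homogeneous morphisms from x_0 to x_n. *)
Inductive path (R : comPzRingType) (O : Type) (h : gquiver R O) (x : O) :
    O -> Type :=
| pnil : path h x x
| pcons y z d (f : h y z d) (p : path h x y) : path h x z.
Arguments pnil {R O h} x.
Arguments pcons {R O h x y z d} f p.

Section Paths.
Variables (R : comPzRingType) (O : Type) (h : gquiver R O).
Implicit Types x y z : O.

Fixpoint pcat x y z (q : path h y z) (p : path h x y) : path h x z :=
  match q in path _ _ z return path h x z with
  | pnil => p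
  | pcons _ _ _ f q' => pcons f (pcat q' p)
  end.

Fixpoint plen x y (p : path h x y) : nat :=
  if p is pcons _ _ _ _ p' then (plen p').+1 else 0.

Fixpoint pdeg x y (p : path h x y) : int :=
  if p is pcons _ _ d _ p' then d + pdeg p' else 0.

(* The degree of m^n(f_n, .., f_1). *)
Definition mdeg x y (p : path h x y) : int := pdeg p + 2 - (plen p)%:Z.

Record psplit x z :=
  PSplit { pmid : O; plow : path h x pmid; phigh : path h pmid z }.

(* All the ways of writing [p] as [pcat (phigh s) (plow s)]. *)
Fixpoint splits x y (p : path h x y) : seq (psplit x y) :=
  match p in path _ _ y return seq (psplit x y) with
  | pnil => [:: PSplit (pnil x) (pnil x)]
  | pcons _ _ _ f p' =>
      PSplit (pcons f p') (pnil _)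
      :: [seq PSplit (plow s) (pcons f (phigh s)) | s <- splits p']
  end.

Definition operations :=
  forall x y, path h x y -> forall e : int, h x y e.

(* Here (f_n, .., f_1) = p, (f_d, .., f_1) = plow s,
   (f_{d+m}, .., f_{d+1}) = plow t and (f_n, .., f_{d+m+1}) = phigh t. *)
Definition ainf_sum (m : operations) x y (p : path h x y) (e : int) : h x y e :=
  \sum_(s <- splits p) \sum_(t <- splits (phigh s) | (0 < plen (plow t))%N)
    (-1) ^+ `|pdeg (plow s) - (plen (plow s))%:Z|%N *:
    m x y (pcat (phigh t)
             (pcons (m _ _ (plow t) (mdeg (plow t))) (plow s))) e.

Lemma pcat_rcons x y z w d (q : path h z w) (f : h y z d) (p : path h x y) :
  pcat q (pcons f p) = pcat (pcat q (pcons f (pnil y))) p.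
Proof. by elim: q => [|? ? ? g q IH] //=; rewrite IH. Qed.

End Paths.

Section PathMaps.
Variables (R : comPzRingType) (O O' : Type).
Variables (h : gquiver R O) (h' : gquiver R O') (f0 : O -> O').
Variable f1 : forall x y d, h x y d -> h' (f0 x) (f0 y) d.

Fixpoint pmap x y (p : path h x y) : path h' (f0 x) (f0 y) :=
  match p in path _ _ y return path h' (f0 x) (f0 y) with
  | pnil => pnil (f0 x)
  | pcons _ _ _ f p' => pcons (f1 f) (pmap p')
  end.

Lemma pmap_cat x y z (q : path h y z) (p : path h x y) :
  pmap (pcat q p) = pcat (pmap q) (pmap p).
Proof. by elim: q => [|? ? ? f q IH] //=; rewrite IH. Qed.

Lemma plen_pmap x y (p : path h x y) : plen (pmap p) = plen p.
Proof. by elim: p => [|? ? ? f p /= ->]. Qed.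

Lemma pdeg_pmap x y (p : path h x y) : pdeg (pmap p) = pdeg p.
Proof. by elim: p => [|? ? ? f p /= ->]. Qed.

Lemma mdeg_pmap x y (p : path h x y) : mdeg (pmap p) = mdeg p.
Proof. by rewrite /mdeg plen_pmap pdeg_pmap. Qed.

Lemma splits_pmap x y (p : path h x y) :
  splits (pmap p) =
  [seq PSplit (pmap (plow s)) (pmap (phigh s)) | s <- splits p].
Proof. by elim: p => [|? ? ? f p /= ->] //=; rewrite -!map_comp. Qed.

Lemma ainf_sum_pmap (m : operations h) (m' : operations h') :
  (forall x y d, linear (@f1 x y d)) ->
  (forall x y (p : path h x y) e, f1 (m x y p e) = m' _ _ (pmap p) e) ->
  forall x y (p : path h x y) e,
    f1 (ainf_sum m p e) = ainf_sum m' (pmap p) e.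
Proof.
move=> lin mm x y p e.
have f1D u v : @f1 x y e (u + v) = f1 u + f1 v.
  by rewrite -[u]scale1r lin !scale1r.
have f10 : @f1 x y e 0 = 0.
  by apply: (addIr (@f1 x y e 0)); rewrite -f1D !add0r.
have f1Z a u : @f1 x y e (a *: u) = a *: f1 u.
  by rewrite -[a *: u]addr0 lin f10 addr0.
rewrite /ainf_sum splits_pmap big_map (big_morph _ f1D f10).
apply: eq_bigr => s _ /=.
rewrite splits_pmap big_map (big_morph _ f1D f10).
apply: eq_big => t /=; first by rewrite plen_pmap.
by move=> _; rewrite f1Z mm pmap_cat /= mm plen_pmap pdeg_pmap mdeg_pmap.
Qed.

End PathMaps.

Lemma pmap_comp (R : comPzRingType) (O : Type) (h h' h'' : gquiver R O)
    (f : forall x y d, h x y d -> h' x y d)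
    (g : forall x y d, h' x y d -> h'' x y d) x y (p : path h x y) :
  pmap (f0 := id) g (pmap (f0 := id) f p)
  = pmap (f0 := id) (fun x y d u => g x y d (f x y d u)) p.
Proof. by elim: p => [|? ? ? u p /= ->]. Qed.

Lemma pmap_id (R : comPzRingType) (O : Type) (h : gquiver R O)
    (f : forall x y d, h x y d -> h x y d) :
  (forall x y d u, f x y d u = u) ->
  forall x y (p : path h x y), pmap (f0 := id) f p = p.
Proof. by move=> fE x y; elim=> [|? ? ? u p /= ->] //; rewrite fE. Qed.

Record dgquiver (R : comPzRingType) (O : Type) := DGQuiver {
  dghom :> gquiver R O;
  diff : forall x y d, dghom x y d -> dghom x y (d + 1);
  diff_linear : forall x y d, linear (@diff x y d);
  diffK : forall x y d (f : dghom x y d), diff (diff f) = 0 }.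

(* Non unital A_oo-categories. [m p e] is the degree [e] component of
   m^n(f_n, .., f_1) for p = (f_n, .., f_1); by [m_deg] the only possibly
   nonzero one has degree sum_i deg f_i + 2 - n. Indexing by [e] avoids
   transports along equalities of degrees. An R-linear map out of the tensor
   product is a multilinear map ([m_linear]), and there is no m^0 ([m_nil]). *)
Record ainf (R : comPzRingType) (O : Type) := AInf {
  ahom :> gquiver R O;
  m : operations ahom;
  m_nil : forall x e, m (pnil x) e = 0;
  m_deg : forall x y (p : path ahom x y) e, e != mdeg p -> m p e = 0;
  m_linear : forall x y z w d (q : path ahom z w) (p : path ahom x y) e,
    linear (fun f : ahom y z d => m (pcat q (pcons f p)) e);
  m_rel : forall x y (p : path ahom x y) e, ainf_sum m p e = 0 }.

Section Forget.
Variables (R : comPzRingType) (O : Type) (A : ainf R O).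

Definition m1 x y d (f : A x y d) : A x y (d + 1) :=
  m (pcons f (pnil x)) (d + 1).

Lemma m1_linear x y d : linear (@m1 x y d).
Proof.
exact: (@m_linear _ _ A _ _ _ _ _ (pnil y) (pnil x)).
Qed.

Lemma mdeg1 x y d (f : A x y d) : mdeg (pcons f (pnil x)) = d + 1.
Proof. by rewrite /mdeg /= addr0 -addrA. Qed.

Lemma m1K x y d (f : A x y d) : m1 (m1 f) = 0.
Proof.
have := m_rel (pcons f (pnil x)) (d + 1 + 1).
rewrite /ainf_sum /= !(big_cons, big_nil) /=.
by rewrite addn0 expr0 scale1r !addr0 add0r mdeg1.
Qed.

Definition forget : dgquiver R O := DGQuiver m1_linear m1K.

End Forget.

Section Maps.
Variables (R : comPzRingType) (O O' : Type).

Definition is_dgmap (Q : dgquiver R O) (Q' : dgquiver R O') (f0 : O -> O')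
    (f1 : forall x y d, Q x y d -> Q' (f0 x) (f0 y) d) : Prop :=
  (forall x y d, linear (@f1 x y d)) /\
  (forall x y d (f : Q x y d), f1 _ _ _ (diff f) = diff (f1 _ _ _ f)).

Definition is_strict (A : ainf R O) (B : ainf R O') (f0 : O -> O')
    (f1 : forall x y d, A x y d -> B (f0 x) (f0 y) d) : Prop :=
  (forall x y d, linear (@f1 x y d)) /\
  (forall x y (p : path A x y) e, f1 _ _ _ (m p e) = m (pmap f1 p) e).

End Maps.
Arguments is_dgmap {R O O'} Q Q' f0 f1.
Arguments is_strict {R O O'} A B f0 f1.

Section StrictUnits.
Variables (R : comPzRingType) (O : Type).

Definition strict_unit (A : ainf R O) (x : O) (u : A x x 0) : Prop :=
  [/\ m1 u = 0,
      forall y d (f : A x y d), m (pcons f (pcons u (pnil x))) d = f,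
      forall y d (f : A y x d),
        (-1) ^+ `|d|%N *: m (pcons u (pcons f (pnil y))) d = f
    & forall y z (q : path A x z) (p : path A y x) e,
        (2 <= plen q + plen p)%N -> m (pcat q (pcons u p)) e = 0].

Record suainf := SUAInf {
  sua :> ainf R O;
  one : forall x, sua x x 0;
  oneP : forall x, strict_unit (one x) }.

End StrictUnits.
Arguments one {R O} s x.

Record sufunctor (R : comPzRingType) (O O' : Type)
    (A : suainf R O) (B : suainf R O') := SUFunctor {
  fob :> O -> O';
  fmor : forall x y d, A x y d -> B (fob x) (fob y) d;
  fmor_strict : is_strict A B fob fmor;
  fmor_one : forall x, fmor (one A x) = one B (fob x) }.
Arguments fmor {R O O' A B} s {x y d}.

Section Composition.
Variables (R : comPzRingType) (O O' O'' : Type).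
Variables (A : suainf R O) (B : suainf R O') (C : suainf R O'').
Variables (G : sufunctor B C) (F : sufunctor A B).

Definition comp_mor x y d (f : A x y d) : C (G (F x)) (G (F y)) d :=
  fmor G (fmor F f).

Lemma comp_strict : is_strict A C (fun x => G (F x)) comp_mor.
Proof.
have [linF mF] := fmor_strict F; have [linG mG] := fmor_strict G.
split=> [x y d a u v|x y p e]; first by rewrite /comp_mor linF linG.
rewrite {1}/comp_mor mF mG; congr (@m _ _ _ _ _ _ e).
by elim: p => [|? ? ? f p /= ->].
Qed.

Lemma comp_one x : comp_mor (one A x) = one C (G (F x)).
Proof. by rewrite /comp_mor !fmor_one. Qed.

Definition sucomp : sufunctor A C := SUFunctor comp_strict comp_one.

End Composition.

Section QuasiEquivalence.
Variables (R : comPzRingType).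

Definition cocycle O (A : ainf R O) x y d (f : A x y d) : Prop := m1 f = 0.

Definition coboundary O (A : ainf R O) x y d (f : A x y d) : Prop :=
  exists g : A x y (d - 1), m (pcons g (pnil x)) d = f.

(* The classes of [u] and [v] are inverse isomorphisms in H^0(A). *)
Definition H0_iso O (A : suainf R O) x y : Prop :=
  exists (u : A x y 0) (v : A y x 0),
    [/\ cocycle u, cocycle v,
        coboundary (m (pcons v (pcons u (pnil x))) 0 - one A x)
      & coboundary (m (pcons u (pcons v (pnil y))) 0 - one A y)].

Variables (O O' : Type) (A : suainf R O) (B : suainf R O') (F : sufunctor A B).

(* Injectivity and surjectivity of F^1 on cohomology, in every degree. *)
Definition quasi_iso_on_homs : Prop :=
  forall x y d,
    (forall f : A x y d, cocycle f -> coboundary (fmor F f) -> coboundary f) /\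
    (forall g : B (F x) (F y) d, cocycle g ->
       exists f : A x y d, cocycle f /\ coboundary (fmor F f - g)).

Definition quasi_equivalence : Prop :=
  quasi_iso_on_homs /\ (forall b : O', exists a : O, H0_iso B (F a) b).

Definition surjective_on_morphisms : Prop :=
  forall x y d (g : B (F x) (F y) d), exists f : A x y d, fmor F f = g.

End QuasiEquivalence.

Section Subobjects.
Variables (R : comPzRingType) (O : Type).

Record subquiver (h : gquiver R O) := SubQuiver {
  sq_mem :> forall x y d, submodClosed (h x y d) }.

Definition subq_le (h : gquiver R O) (S T : subquiver h) : Prop :=
  forall x y d (f : h x y d), f \in S x y d -> f \in T x y d.

Definition gsub (h : gquiver R O) (S : subquiver h) : gquiver R O :=
  GQuiver (fun x y d => submod (S x y d)).

Definition sval1 (h : gquiver R O) (S : subquiver h) x y d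
  (f : gsub S x y d) : h x y d := \val f.
Arguments sval1 {h} S x y d f.

Definition gincl (h : gquiver R O) (S T : subquiver h) (ST : subq_le S T)
    x y d (f : gsub S x y d) : gsub T x y d :=
  exist _ (\val f) (ST x y d (\val f) (valP f)).

(* DG subquivers, with the same objects. *)
Record subdg (Q : dgquiver R O) := SubDG {
  subdg_q :> subquiver Q;
  subdg_diff : forall x y d (f : Q x y d),
    f \in subdg_q x y d -> diff f \in subdg_q x y (d + 1) }.

Section DGSub.
Variables (Q : dgquiver R O) (S : subdg Q).
Definition sub_diff x y d (f : gsub S x y d) : gsub S x y (d + 1) :=
  exist _ (diff (\val f)) (subdg_diff (valP f)).
Lemma sub_diff_linear x y d : linear (@sub_diff x y d).
Proof.
by move=> a u v; apply: val_inj; rewrite linearP /= diff_linear.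
Qed.
Lemma sub_diffK x y d (f : gsub S x y d) : sub_diff (sub_diff f) = 0.
Proof. by apply: val_inj; rewrite /= diffK. Qed.
Definition dgsub : dgquiver R O := DGQuiver sub_diff_linear sub_diffK.
End DGSub.

(* A_oo-subcategories, with the same objects. *)
Record subainf (A : ainf R O) := SubAInf {
  suba_q :> subquiver A;
  suba_m : forall x y (p : path (gsub suba_q) x y) e,
    m (pmap (f0 := id) (sval1 suba_q) p) e \in suba_q x y e }.

Section ASub.
Variables (A : ainf R O) (S : subainf A).
Definition sub_m : operations (gsub S) :=
  fun x y p e => exist _ (m (pmap (f0 := id) (sval1 S) p) e) (suba_m p e).
Lemma sub_m_nil x e : sub_m (pnil x) e = 0.
Proof. by apply: val_inj; rewrite /= m_nil. Qed.
Lemma sub_m_deg x y (p : path (gsub S) x y) e :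
  e != mdeg p -> sub_m p e = 0.
Proof. by move=> ne; apply: val_inj; rewrite /= m_deg // mdeg_pmap. Qed.
Lemma sub_m_linear x y z w d (q : path (gsub S) z w) (p : path (gsub S) x y) e :
  linear (fun f : gsub S y z d => sub_m (pcat q (pcons f p)) e).
Proof.
move=> a u v; apply: val_inj; rewrite linearP /= !pmap_cat /=.
rewrite /sval1 linearP.
exact: (@m_linear _ _ A _ _ _ _ _ (pmap (f0 := id) (sval1 S) q)
                          (pmap (f0 := id) (sval1 S) p) e a).
Qed.
Lemma sub_m_rel x y (p : path (gsub S) x y) e : ainf_sum sub_m p e = 0.
Proof.
apply: val_inj.
have lin x' y' d : linear (@sval1 _ S x' y' d) by apply: submod_val_linear.
have := ainf_sum_pmap (f0 := id) (m := sub_m) (m' := @m _ _ A) lin.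
by move=> /(_ (fun _ _ _ _ => erefl) _ _ p e); rewrite m_rel.
Qed.
Definition asub : ainf R O :=
  AInf sub_m_nil sub_m_deg sub_m_linear sub_m_rel.

Lemma suba_diff x y d (f : A x y d) : f \in S x y d -> m1 f \in S x y (d + 1).
Proof.
move=> Sf; exact: (suba_m (pcons (exist _ f Sf : gsub S x y d) (pnil x))).
Qed.
Definition subainf_dg : subdg (forget A) := @SubDG (forget A) S suba_diff.
End ASub.

Record subsuainf (A : suainf R O) := SubSUAInf {
  subsu :> subainf A;
  subsu_one : forall x, one A x \in subsu x x 0 }.

Definition sub_one (A : suainf R O) (S : subsuainf A) x : asub S x x 0 :=
  exist _ (one A x) (subsu_one S x).

Section Restriction.
Variables (Q : dgquiver R O) (T S : subdg Q).
Section Hom.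
Variables (x y : O) (d : int).
Definition restr_pred : {pred gsub T x y d} := fun f => \val f \in S x y d.
Lemma restr_closed : submod_closed restr_pred.
Proof.
split=> [|a u v]; first exact: (rpred0 (S x y d)).
move=> Su Sv; rewrite unfold_in /restr_pred linearP.
by rewrite rpredD ?rpredZ.
Qed.
HB.instance Definition _ :=
  GRing.isSubmodClosed.Build R (gsub T x y d) restr_pred restr_closed.
End Hom.
Definition restr_q : subquiver (dgsub T) :=
  SubQuiver (fun x y d => @restr_pred x y d).
Lemma restr_diff x y d (f : dgsub T x y d) :
  f \in restr_q x y d -> diff f \in restr_q x y (d + 1).
Proof. exact: subdg_diff. Qed.
(* The DG subquiver S of T, when S is contained in T. *)
Definition restr : subdg (dgsub T) := SubDG restr_diff.
End Restriction.

End Subobjects.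
Arguments sval1 {R O h} S x y d f.

Section Quotients.
Variables (R : comPzRingType) (O : Type).

Definition gquot (h : gquiver R O) (S : subquiver h) : gquiver R O :=
  GQuiver (fun x y d => quotmod (S x y d)).
Definition gpi (h : gquiver R O) (S : subquiver h) x y d (f : h x y d) :
  gquot S x y d := qpi (S x y d) f.
Definition grepr (h : gquiver R O) (S : subquiver h) x y d
  (c : gquot S x y d) : h x y d := qrepr c.

Section DGQuot.
Variables (Q : dgquiver R O) (S : subdg Q).
Definition quot_diff x y d (c : gquot S x y d) : gquot S x y (d + 1) :=
  gpi S (diff (grepr c)).
Lemma quot_diff_pi x y d (f : Q x y d) :
  quot_diff (gpi S f) = gpi S (diff f).
Proof.
apply/qpi_eq; rewrite -(linear_sub (@diff_linear _ _ Q x y d)).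
exact/subdg_diff/qpiK.
Qed.
Lemma quot_diff_linear x y d : linear (@quot_diff x y d).
Proof.
move=> a u v; rewrite -[u]qreprK -[v]qreprK -qpi_linear !quot_diff_pi.
by rewrite diff_linear [gpi _ _]qpi_linear.
Qed.
Lemma quot_diffK x y d (c : gquot S x y d) : quot_diff (quot_diff c) = 0.
Proof.
rewrite -[c]qreprK !quot_diff_pi diffK.
by apply: (addIr (gpi S 0)); rewrite -[LHS]qpiD !add0r.
Qed.
Definition dgquot : dgquiver R O := DGQuiver quot_diff_linear quot_diffK.
End DGQuot.

Record ideal (A : ainf R O) := Ideal {
  ideal_dg :> subdg (forget A);
  ideal_m : forall x y z w d (q : path A z w) (f : A y z d) (p : path A x y) e,
    f \in ideal_dg y z d -> m (pcat q (pcons f p)) e \in ideal_dg x w e }.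

Section AQuot.
Variables (A : ainf R O) (I : ideal A).
Local Notation pi := (gpi I).
Definition quot_m : operations (gquot I) := fun x y p e =>
  gpi I (m (pmap (f0 := id) (@grepr A I) p) e).
Lemma m_sub x y z w d (q : path A z w) (p : path A x y) e (f g : A y z d) :
  m (pcat q (pcons (f - g) p)) e
  = m (pcat q (pcons f p)) e - m (pcat q (pcons g p)) e.
Proof.
exact: (linear_sub (@m_linear _ _ A _ _ _ _ _ q p e)).
Qed.
Lemma quot_m_pi x y (p : path A x y) e :
  gpi I (m p e) = quot_m (pmap (f0 := id) (@gpi A I) p) e.
Proof.
apply/qpi_eq; rewrite pmap_comp; move: e.
set rho := (X in pmap X).
suff H z (q : path A y z) e :
    m (pcat q (pmap (f0 := id) rho p)) e - m (pcat q p) e \in I x z e.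
  by move=> e; rewrite -opprB submodN //; apply: (H _ (pnil y)).
elim: p z q => [|y1 y2 d f p IH] z q /=; first by rewrite subrr rpred0.
rewrite -[X in X \in _](subrKA (m (pcat q (pcons f (pmap (f0 := id) rho p))) e)).
rewrite rpredD //; first by rewrite -m_sub ideal_m //; apply: qpiK.
by rewrite (pcat_rcons q f p) (pcat_rcons q f (pmap _ p)); apply: IH.
Qed.
Lemma path_pi x y (p : path (gquot I) x y) :
  p = pmap (f0 := id) (@gpi A I) (pmap (f0 := id) (@grepr A I) p).
Proof.
by rewrite pmap_comp pmap_id // => *; apply: qreprK.
Qed.
Lemma gpi0 x y d : gpi I (0 : A x y d) = 0.
Proof. by apply: (addIr (gpi I 0)); rewrite -[LHS]qpiD !add0r. Qed.
Lemma quot_m_nil x e : quot_m (pnil x) e = 0.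
Proof. by rewrite /quot_m /= m_nil gpi0. Qed.
Lemma quot_m_deg x y (p : path (gquot I) x y) e :
  e != mdeg p -> quot_m p e = 0.
Proof. by move=> ne; rewrite /quot_m m_deg ?gpi0 // mdeg_pmap. Qed.
Lemma quot_m_linear x y z w d
    (q : path (gquot I) z w) (p : path (gquot I) x y) e :
  linear (fun f : gquot I y z d => quot_m (pcat q (pcons f p)) e).
Proof.
move=> a u v; rewrite [q]path_pi [p]path_pi -[u]qreprK -[v]qreprK -qpi_linear.
set q' := pmap _ q; set p' := pmap _ p; set u' := qrepr u; set v' := qrepr v.
have E g : quot_m (pcat (pmap (f0 := id) (@gpi A I) q')
    (pcons (qpi (I y z d) g : gquot I y z d) (pmap (f0 := id) (@gpi A I) p'))) e
    = gpi I (m (pcat q' (pcons g p')) e).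
  by rewrite quot_m_pi pmap_cat.
by rewrite !E m_linear [gpi _ _]qpi_linear.
Qed.
Lemma quot_m_rel x y (p : path (gquot I) x y) e : ainf_sum quot_m p e = 0.
Proof.
rewrite [p]path_pi -(ainf_sum_pmap (m := @m _ _ A)) ?m_rel ?gpi0 //.
  by move=> *; apply: qpi_linear.
by move=> *; apply: quot_m_pi.
Qed.
Definition aquot : ainf R O :=
  AInf quot_m_nil quot_m_deg quot_m_linear quot_m_rel.
End AQuot.

Section GeneratedIdeal.
Variables (A : ainf R O) (r : forall x y d, A x y d -> Prop).
Section Hom.
Variables (x y : O) (d : int).
Definition gen_pred : {pred A x y d} := fun f =>
  `[< forall I : ideal A,
        (forall x' y' d' (g : A x' y' d'), r g -> g \in I x' y' d') ->
        f \in I x y d >].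
Lemma gen_closed : submod_closed gen_pred.
Proof.
split=> [|a u v]; rewrite !unfold_in; first by apply/asboolP => I _; apply: rpred0.
move=> /asboolP Hu /asboolP Hv; apply/asboolP => I rI.
by rewrite rpredD ?rpredZ ?Hu ?Hv.
Qed.
HB.instance Definition _ :=
  GRing.isSubmodClosed.Build R (A x y d) gen_pred gen_closed.
End Hom.
Definition gen_q : subquiver A := SubQuiver (fun x y d => @gen_pred x y d).
Lemma gen_diff x y d (f : A x y d) :
  f \in gen_q x y d -> m1 f \in gen_q x y (d + 1).
Proof.
by move=> /asboolP Hf; apply/asboolP => I rI; apply: (subdg_diff (s := I)); apply: Hf.
Qed.
Definition gen_dg : subdg (forget A) := @SubDG _ _ (forget A) gen_q gen_diff.
Lemma gen_m x y z w d (q : path A z w) (f : A y z d) (p : path A x y) e :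
  f \in gen_dg y z d -> m (pcat q (pcons f p)) e \in gen_dg x w e.
Proof.
by move=> /asboolP Hf; apply/asboolP => I rI; apply: ideal_m; apply: Hf.
Qed.
Definition gen_ideal : ideal A := Ideal gen_m.
End GeneratedIdeal.

End Quotients.

(* disc: the degree [d] part of Hom(x, y) is realized as the submodule of R
   equal to R (with 1_x = 1) if x = y and d = 0, and to 0 otherwise. *)
Section Disc.
Variables (R : comPzRingType) (O : Type).

Section Hom.
Variables (x y : O) (d : int).
Definition disc_pred : {pred R^o} := fun r => `[< (x = y /\ d = 0) \/ r = 0 >].
Lemma disc_closed : submod_closed disc_pred.
Proof.
split=> [|a u v]; rewrite !unfold_in; first by apply/asboolP; right.
move=> /asboolP [h|->] /asboolP h'; apply/asboolP; first by left.
by case: h' => [h|->]; [left | right; rewrite scaler0 addr0].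
Qed.
HB.instance Definition _ :=
  GRing.isSubmodClosed.Build R R^o disc_pred disc_closed.
Definition disc_sub : submodClosed R^o := disc_pred.
End Hom.

Definition disc_q : gquiver R O := GQuiver (fun x y d => submod (disc_sub x y d)).

Fixpoint pprod x y (p : path disc_q x y) : R^o :=
  if p is pcons _ _ _ f p' then (\val f : R) * pprod p' else 1.

Definition disc_val x y (p : path disc_q x y) (e : int) : R^o :=
  if (plen p == 2) && (e == mdeg p) then pprod p else 0.

Lemma pprod0 x y (p : path disc_q x y) :
  (x = y /\ pdeg p = 0) \/ pprod p = 0.
Proof.
elim: p => [|y' z d f p IH] /=; first by left.
case: IH => [[xy p0]|->]; last by right; rewrite mulr0.
have /asboolP[[yz d0]|f0] := valP f; last by right; rewrite [val f]f0 mul0r.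
by left; split; [exact: etrans xy yz | rewrite d0 p0].
Qed.

Lemma disc_val_mem x y (p : path disc_q x y) e :
  disc_val p e \in disc_sub x y e.
Proof.
apply/asboolP; rewrite /disc_val; case: ifP => [/andP[/eqP l2 /eqP ->]|_]; last by right.
case: (pprod0 p) => [[xy p0]|]; last by right.
by left; split=> //; rewrite /mdeg p0 l2 add0r subrr.
Qed.

Definition disc_m : operations disc_q :=
  fun x y p e => exist _ (disc_val p e) (disc_val_mem p e).

Lemma pprod_cat x y z (q : path disc_q y z) (p : path disc_q x y) :
  pprod (pcat q p) = (pprod q : R) * pprod p.
Proof. by elim: q => [|? ? ? f q IH] /=; rewrite ?mul1r // IH mulrA. Qed.

Lemma plen_cat x y z (h : gquiver R O) (q : path h y z) (p : path h x y) :
  plen (pcat q p) = (plen q + plen p)%N.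
Proof. by elim: q => [|? ? ? f q IH] //=; rewrite IH. Qed.

Lemma pdeg_cat x y z (h : gquiver R O) (q : path h y z) (p : path h x y) :
  pdeg (pcat q p) = pdeg q + pdeg p.
Proof. by elim: q => [|? ? ? f q IH] /=; rewrite ?add0r // IH addrA. Qed.

Lemma disc_m_nil x e : disc_m (pnil x) e = 0.
Proof. exact: val_inj. Qed.

Lemma disc_m_deg x y (p : path disc_q x y) e : e != mdeg p -> disc_m p e = 0.
Proof. by move=> /negbTE ne; apply: val_inj; rewrite /= /disc_val ne andbF. Qed.

Lemma disc_m_linear x y z w d
    (q : path disc_q z w) (p : path disc_q x y) e :
  linear (fun f : disc_q y z d => disc_m (pcat q (pcons f p)) e).
Proof.
move=> a u v; apply: val_inj; rewrite linearP /= /disc_val.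
have E f g : plen (pcat q (@pcons _ _ _ _ _ _ d f p))
             = plen (pcat q (@pcons _ _ _ _ _ _ d g p)) by rewrite !plen_cat.
have E' f g : mdeg (pcat q (@pcons _ _ _ _ _ _ d f p))
             = mdeg (pcat q (@pcons _ _ _ _ _ _ d g p)).
  by rewrite /mdeg !pdeg_cat (E f g).
rewrite !(E _ 0) !(E' _ 0); case: ifP => _; last by rewrite scaler0 addr0.
rewrite !pprod_cat.
have -> : pprod (pcons (a *: u + v) p)
    = (a * (\val u : R) + (\val v : R)) * pprod p.
  by congr (_ * _); apply: (submod_val_linear a u v).
rewrite /= mulrDl mulrDr; congr (_ + _).
by rewrite -mulrA mulrCA.
Qed.

Lemma splits_plen x y (h : gquiver R O) (p : path h x y) :
  all (fun s => plen (plow s) + plen (phigh s) == plen p)%N (splits p).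
Proof.
elim: p => [|? ? ? f p IH] //=; rewrite addn0 eqxx all_map /=.
by apply: sub_all IH => s /= /eqP <-; rewrite addnS.
Qed.

Lemma big_all0 (V : zmodType) (I : Type) (P Q : pred I) (r : seq I) (F : I -> V) :
  all P r -> (forall i, P i -> F i = 0) -> \sum_(i <- r | Q i) F i = 0.
Proof.
move=> + H; elim: r => [|i r IH] /=; first by rewrite big_nil.
by case/andP => /H Fi /IH IHr; rewrite big_cons IHr Fi addr0; case: ifP.
Qed.

Lemma ainf_sum3 (h : gquiver R O) (m : operations h) x y z w d1 d2 d3
    (f1 : h x y d1) (f2 : h y z d2) (f3 : h z w d3) e :
  (forall x y (p : path h x y) e, plen p != 2 -> m x y p e = 0) ->
  let p12 := pcons f2 (pcons f1 (pnil x)) in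
  let p23 := pcons f3 (pcons f2 (pnil y)) in
  ainf_sum m (pcons f3 p12) e
  = (-1) ^+ `|d1 - 1|%N *:
      m x w (pcons (m y w p23 (mdeg p23)) (pcons f1 (pnil x))) e
    + m x w (pcons f3 (pcons (m x z p12 (mdeg p12)) (pnil x))) e.
Proof.
move=> m2 p12 p23; rewrite /ainf_sum /= !(big_cons, big_nil) /=.

rewrite !(m2 _ _ (pcons _ (pcons _ (pcons _ (pnil _)))) _ isT).
rewrite !(m2 _ _ (pcons _ (pnil _)) _ isT).
by rewrite !scaler0 !addr0 !add0r expr0 scale1r addrC.
Qed.

Lemma disc_m_rel x y (p : path disc_q x y) e : ainf_sum disc_m p e = 0.
Proof.
have [p3|] := eqVneq (plen p) 3; last first.
  move=> p3; apply: big_all0 (splits_plen p) _ => s /eqP sp.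
  apply: big_all0 (splits_plen _) _ => t /eqP tp.
  apply: val_inj; rewrite linearZ /= /disc_val plen_cat /=.
  case: ifP => [/andP[/eqP l2 _]|_]; last by rewrite scaler0.
  rewrite pprod_cat /= /disc_val; case: ifP => [/andP[/eqP l2' _]|_].
    by case/eqP: p3; rewrite -sp -tp l2' addnCA -l2; lia.
  by rewrite mul0r mulr0 scaler0.
move: p3; case: p => [|y3 z3 d3 f3 p] //; case: p f3 => [|y2 z2 d2 f2 p] f3 //.
case: p f2 => [|y1 z1 d1 f1 p] f2 //; case: p f1 => // f1 _.
rewrite ainf_sum3; last first.
  by move=> ? ? p' e' /negbTE l2; apply: val_inj; rewrite /= /disc_val l2.
apply: val_inj.
cbv zeta; set p12 := pcons f2 (pcons f1 _); set p23 := pcons f3 (pcons f2 _).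
set u := disc_m p12 _; set v := disc_m p23 _.
have Eu : val u = pprod p12 by rewrite /= /disc_val eqxx.
have Ev : val v = pprod p23 by rewrite /= /disc_val eqxx.
set a := disc_m _ e; set b := disc_m _ e.
have Ea : val a = if e == mdeg (pcons f3 p12) + 1 then (val v : R) * val f1 else 0.
  rewrite /= /disc_val /= mulr1; congr (if _ then _ else _).
  by congr (e == _); rewrite /mdeg /=; lia.
have Eb : val b = if e == mdeg (pcons f3 p12) + 1 then (val f3 : R) * val u else 0.
  rewrite /= /disc_val /= mulr1; congr (if _ then _ else _).
  by congr (e == _); rewrite /mdeg /=; lia.
apply: etrans (submod_val_linear _ a b) _; cbv beta.
rewrite Ea Eb Eu Ev; clearbody u v a b.
case: ifP => _; last by rewrite scaler0 addr0.
rewrite /p12 /p23 /= !mulr1 mulrA.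
have /asboolP[[_ d0]|f0] := valP f1; last by rewrite [val f1]f0 mulr0 scaler0 addr0.
have -> : (-1) ^+ `|d1 - 1|%N = -1 :> R by rewrite d0 expr1.
by rewrite scaleN1r addNr.
Qed.

Definition disc : ainf R O :=
  AInf disc_m_nil disc_m_deg disc_m_linear disc_m_rel.

End Disc.

Section Free.
Variables (R : comPzRingType) (O : Type).

(* [F] is the free A_oo-category on [Q], i.e. the value at [Q] of the left
   adjoint of [forget], and [eta] is the unit of the adjunction. *)
Definition is_free (Q : dgquiver R O) (F : ainf R O)
    (eta : forall x y d, Q x y d -> F x y d) : Prop :=
  is_dgmap Q (forget F) id eta /\
  forall (O' : Type) (C : ainf R O') (f0 : O -> O')
      (phi : forall x y d, Q x y d -> C (f0 x) (f0 y) d),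
    is_dgmap Q (forget C) f0 phi ->
    exists! H : forall x y d, F x y d -> C (f0 x) (f0 y) d,
      is_strict F C f0 H /\
      (forall x y d (f : Q x y d), H x y d (eta x y d f) = phi x y d f).

(* The relations imposed on [F] for [i] to induce a strict functor from [S]
   sending the [u x] to strict units. *)
Inductive attach_rel (S F : ainf R O) (i : forall x y d, S x y d -> F x y d)
    (u : forall x, S x x 0) : forall x y d, F x y d -> Prop :=
| attach_m x y (p : path S x y) e : (2 <= plen p)%N ->
    attach_rel i u (m (pmap (f0 := id) i p) e - i x y e (m p e))
| attach_unit_r x y d (f : F x y d) :
    attach_rel i u (m (pcons f (pcons (i x x 0 (u x)) (pnil x))) d - f)
| attach_unit_l x y d (f : F x y d) :
    attach_rel i u
      ((-1) ^+ `|d|%N *: m (pcons (i y y 0 (u y)) (pcons f (pnil x))) d - f)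
| attach_unit_n x y z (q : path F y z) (p : path F x y) e :
    (2 <= plen q + plen p)%N ->
    attach_rel i u (m (pcat q (pcons (i y y 0 (u y)) p)) e).

End Free.
Arguments is_free {R O} Q F eta.

Section SemiFree.
Variables (R : comPzRingType) (O : Type) (A : suainf R O).

(* A_n ~ F(Q_n)/I_n, where [S] = A_{n-1}, [Q] = Q_n and [S'] = A_n. *)
Definition free_attachment (S S' : subsuainf A) (Q : subdg (forget A))
    (SQ : subq_le S Q) : Prop :=
  exists (F : ainf R O) (eta : forall x y d, dgsub Q x y d -> F x y d),
    is_free (dgsub Q) F eta /\
    let i x y d (f : asub S x y d) := eta x y d (gincl SQ f) in
    let I := gen_ideal (attach_rel i (sub_one S)) in
    exists Phi : forall x y d, aquot I x y d -> asub S' x y d,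
      [/\ is_strict (aquot I) (asub S') id Phi,
          forall x y d, bijective (Phi x y d)
        & forall x y d (f : dgsub Q x y d),
            \val (Phi x y d (gpi I (eta x y d f))) = \val f].

Arguments free_attachment S S' Q SQ : clear implicits.

(* Here [S n] = A_n and [Q n] = Q_{n+1}. In [sf_split], [B] is the graded quiver
   B_{n+1}, seen inside [Q n] as a complement of [S n]. In [sf_quot_free], a
   graded module is free when it has a homogeneous basis, i.e. when each of its
   graded pieces is free. *)
Record semifree_filtration (S : nat -> subsuainf A)
    (Q : nat -> subdg (forget A)) : Prop := SemiFreeFiltration {
  sf_SQ : forall n, subq_le (S n) (Q n);
  sf_QS : forall n, subq_le (Q n) (S n.+1);
  sf_union : forall x y d (f : A x y d), exists n, f \in S n x y d;
  sf_disc : exists (f0 : O -> O)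
      (D : forall x y d, disc R O x y d -> A (f0 x) (f0 y) d),
    [/\ is_strict (disc R O) A f0 D, bijective f0,
        forall x y d, injective (D x y d)
      & forall x y d (f : A (f0 x) (f0 y) d),
          f \in S 0 (f0 x) (f0 y) d <-> exists r, D x y d r = f];
  sf_split : forall n, exists B : subquiver A,
    [/\ subq_le B (Q n),
        forall x y d f, f \in Q n x y d ->
          exists a b, [/\ a \in S n x y d, b \in B x y d & f = a + b]
      & forall x y d f, f \in S n x y d -> f \in B x y d -> f = 0];
  sf_attach : forall n, free_attachment (S n) (S n.+1) (Q n) (@sf_SQ n);
  sf_quot_diff : forall n x y d
      (c : dgquot (restr (Q n) (subainf_dg (S n))) x y d), diff c = 0;
  sf_quot_free : forall n x y d,
    free_module (dgquot (restr (Q n) (subainf_dg (S n))) x y d) }.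

Definition semifree : Prop := exists S Q, semifree_filtration S Q.

End SemiFree.

(* Main.v *)
From HB Require Import structures.
From mathcomp Require Import all_boot all_order all_algebra.
From mathcomp Require Import boolp.
Require Import Defs.

Set Implicit Arguments.
Unset Strict Implicit.
Unset Printing Implicit Defensive.

(** The lift is built along the semi-free filtration: strict unital functors
    from the successive subcategories A_n to C, each extending the previous one
    and each lifted from F through G, are glued along the union.

    On objects, choose a preimage under G of every F x. Once F is rewritten as
    x |-> G (f0 x) on objects, no transport along equalities of objects is left.

    The subcategory A_0 consists of the multiples of the units, freely, so a
    strict unital functor on it is forced to send r 1_x to r 1_(f0 x), and this
    is a lift ([partial_lift_disc]).

    To pass from A_n to A_(n+1), the lift H on A_n is first extended to the DG
    quiver Q_(n+1) ([dg_extension]). The differential of an element q of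
    Q_(n+1) representing a basis element of Q_(n+1)/A_n lies in A_n, and one
    needs w over F q with dw = H (dq). It exists because G, being a
    quasi-isomorphism surjective on morphisms, lifts every such pair
    ([acyclic_fibration_lift]). Freeness of the quotient turns these choices
    into a DG map ([free_module_ext]).

    The DG map then extends to the free A_oo-category on Q_(n+1) by its
    universal property. The extension kills the relations that present A_(n+1),
    because H is strict and unital and C is strictly unital, so it descends to
    A_(n+1) ([strict_factor]). The result lies over F because both composites
    to B are determined by their restriction to Q_(n+1)
    ([attachment_lift]). *)

Import GRing.Theory.
Local Open Scope ring_scope.

(** * Linear maps and free modules *)

Section RawLinear.
Variables (R : comPzRingType) (U V : lmodType R) (f : U -> V).
Hypothesis f_lin : linear f.

Lemma linear_zero : f 0 = 0.
Proof. by rewrite -[X in f X](subrr 0) linear_sub // subrr. Qed.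

Lemma linear_add u v : f (u + v) = f u + f v.
Proof. by rewrite -[u]scale1r f_lin !scale1r. Qed.

Lemma linear_scale a u : f (a *: u) = a *: f u.
Proof. by rewrite -[a *: u]addr0 f_lin linear_zero addr0. Qed.

Lemma linear_sum I (r : seq I) (a : I -> R) (u : I -> U) :
  f (\sum_(i <- r) a i *: u i) = \sum_(i <- r) a i *: f (u i).
Proof.
rewrite (big_morph _ linear_add linear_zero).
by apply: eq_bigr => i _; rewrite linear_scale.
Qed.
End RawLinear.

Section LinearCompositions.
Variables (R : comPzRingType) (U V W : lmodType R).

Lemma linear_comp (f : U -> V) (g : V -> W) :
  linear f -> linear g -> linear (fun u => g (f u)).
Proof. by move=> fL gL a u v; rewrite fL gL. Qed.

Lemma linear_addf (f g : U -> V) :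
  linear f -> linear g -> linear (fun u => f u + g u).
Proof. by move=> fL gL a u v; rewrite fL gL scalerDr addrACA. Qed.

Lemma linear_subf (f g : U -> V) :
  linear f -> linear g -> linear (fun u => f u - g u).
Proof.
by move=> fL gL a u v; rewrite fL gL scalerBr opprD addrACA.
Qed.

Lemma linear_corestrict (S : submodClosed V) (f : U -> V)
    (Sf : forall u, f u \in S) :
  linear f -> linear (fun u => exist _ (f u) (Sf u) : submod S).
Proof. by move=> fL a u v; apply: val_inj; rewrite linearP /= fL. Qed.
End LinearCompositions.

Section FreeModule.
Variables (R : comPzRingType) (M : lmodType R).

(** Freeness is stated for families indexed without repetition; collecting the
    coefficients of equal indices extends it to arbitrary formal combinations,
    which are the ones that can be concatenated. *)
Lemma free_collapse (I : Type) (b : I -> M) :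
  (forall n (i : 'I_n -> I) (a : 'I_n -> R), injective i ->
       \sum_k a k *: b (i k) = 0 -> forall k, a k = 0) ->
  forall (V : lmodType R) (w : I -> V) (s : seq (R * I)),
    \sum_(p <- s) p.1 *: b p.2 = 0 -> \sum_(p <- s) p.1 *: w p.2 = 0.
Proof.
move=> b_free V w; pose J : eqType := {classic I}.
change (forall s : seq (R * J),
  \sum_(p <- s) p.1 *: b p.2 = 0 -> \sum_(p <- s) p.1 *: w p.2 = 0) => s.
pose js := undup [seq p.2 | p <- s].
pose c (j : J) := \sum_(p <- s | p.2 == j) p.1.
have collect (W : lmodType R) (u : I -> W) :
    \sum_(p <- s) p.1 *: u p.2 = \sum_(k < size js) c (tnth (in_tuple js) k)
                                   *: u (tnth (in_tuple js) k).
  rewrite -(big_tnth _ _ js xpredT (fun j => c j *: u j)).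
  under [RHS]eq_bigr => j _ do rewrite scaler_suml.
  rewrite (exchange_big_dep xpredT) //= big_seq [RHS]big_seq.
  apply: eq_bigr => p ps.
  rewrite -big_filter (_ : [seq _ <- _ | _] = [:: p.2]) ?big_seq1 //.
  have pj : p.2 \in js by rewrite mem_undup; apply: (map_f (fun p => p.2)).
  rewrite (eq_filter (a2 := pred1 p.2)); last by move=> j /=; rewrite eq_sym.
  by rewrite filter_pred1_uniq ?undup_uniq.
rewrite collect => /b_free c0; rewrite collect big1 // => k _.
rewrite c0 ?scale0r //.
exact: (elimT (tuple_uniqP (in_tuple js)) (undup_uniq _)).
Qed.

(** The universal property of a free module. All the linear maps out of
    Q_(n+1)/A_n are built and compared with it. *)
Lemma free_module_ext : free_module M ->
  exists (I : Type) (b : I -> M),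
    (forall (V : lmodType R) (w : I -> V),
       exists f : M -> V, linear f /\ forall i, f (b i) = w i)
    /\ (forall (V : lmodType R) (f g : M -> V), linear f -> linear g ->
         (forall i, f (b i) = g (b i)) -> forall v, f v = g v).
Proof.
move=> [I [b [b_free b_gen]]]; exists I, b.
have /choice[r rE] (v : M) :
    exists s : seq (R * I), \sum_(p <- s) p.1 *: b p.2 = v.
  have [n [i [a ->]]] := b_gen v.
  by exists [seq (a k, i k) | k <- index_enum 'I_n]; rewrite big_map.
split=> [V w|V f g fL gL fg v]; last first.
  rewrite -[v]rE (linear_sum fL) (linear_sum gL).
  by apply: eq_bigr => p _; rewrite fg.
have indep s s' : \sum_(p <- s) p.1 *: b p.2 = \sum_(p <- s') p.1 *: b p.2 ->
    \sum_(p <- s) p.1 *: w p.2 = \sum_(p <- s') p.1 *: w p.2.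
  pose s'N := [seq (- p.1, p.2) | p <- s'].
  have catN (W : lmodType R) (u : I -> W) : \sum_(p <- s ++ s'N) p.1 *: u p.2
      = \sum_(p <- s) p.1 *: u p.2 - \sum_(p <- s') p.1 *: u p.2.
    rewrite big_cat big_map -sumrN; congr (_ + _).
    by apply: eq_bigr => p _; rewrite scaleNr.
  move=> /eqP; rewrite -subr_eq0 -catN => /eqP /(free_collapse b_free w).
  by rewrite catN => /eqP; rewrite subr_eq0 => /eqP.
exists (fun v => \sum_(p <- r v) p.1 *: w p.2); split=> [a u v|i]; last first.
  by rewrite (indep _ [:: (1, i)]) ?rE big_seq1 scale1r.
pose auv := [seq (a * p.1, p.2) | p <- r u] ++ r v.
have auvE (W : lmodType R) (z : I -> W) : \sum_(p <- auv) p.1 *: z p.2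
    = a *: (\sum_(p <- r u) p.1 *: z p.2) + \sum_(p <- r v) p.1 *: z p.2.
  rewrite big_cat big_map scaler_sumr; congr (_ + _).
  by apply: eq_bigr => p _; rewrite scalerA.
by rewrite -auvE; apply: indep; rewrite auvE !rE.
Qed.
End FreeModule.

(** * Strict functors, quotients and ideals *)

Section Multilinear.
Variables (R : comPzRingType) (O : Type) (A : ainf R O).

Lemma m_zero x y z w d (q : path A z w) (p : path A x y) e :
  m (pcat q (pcons (0 : A y z d) p)) e = 0.
Proof. exact: linear_zero (@m_linear _ _ A _ _ _ _ _ q p e). Qed.

Lemma m_scale x y z w d a (q : path A z w) (u : A y z d) (p : path A x y) e :
  m (pcat q (pcons (a *: u) p)) e = a *: m (pcat q (pcons u p)) e.
Proof. exact: linear_scale (@m_linear _ _ A _ _ _ _ _ q p e) a u. Qed.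

(** Stated in all degrees, since [m] is indexed by the degree of its value. *)
Lemma m_mK x y d (u : A x y d) e e' :
  m (pcons (m (pcons u (pnil x)) e) (pnil x)) e' = 0.
Proof.
have [->|ne] := eqVneq e (mdeg (pcons u (pnil x))); last first.
  by rewrite (m_deg ne); apply: (@m_zero _ _ _ _ _ (pnil y) (pnil x)).
rewrite mdeg1; have [->|ne] := eqVneq e' (d + 1 + 1); first exact: m1K.
by rewrite m_deg // mdeg1.
Qed.

(** The definition of a coboundary involves Hom in degree (d + 1) - 1, which is
    not convertible to d. *)
Lemma coboundaryP x y d (f : A x y (d + 1)) :
  coboundary f <-> exists g : A x y d, m1 g = f.
Proof.
have shift d' : d' = d ->
    (exists g : A x y d', m (pcons g (pnil x)) (d + 1) = f) <->
    (exists g : A x y d, m1 g = f) by move=> ->.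
by apply: shift; rewrite addrK.
Qed.
End Multilinear.
Arguments m_zero {R O A x y z w d} q p e.

Section Strict.
Variable R : comPzRingType.

Lemma pmap_pmap (O O' O'' : Type) (h : gquiver R O) (h' : gquiver R O')
    (h'' : gquiver R O'') (f0 : O -> O') (g0 : O' -> O'')
    (f : forall x y d, h x y d -> h' (f0 x) (f0 y) d)
    (g : forall x y d, h' x y d -> h'' (g0 x) (g0 y) d) x y (p : path h x y) :
  pmap (f0 := g0) g (pmap (f0 := f0) f p)
  = pmap (f0 := fun x => g0 (f0 x)) (fun x y d u => g _ _ d (f x y d u)) p.
Proof. by elim: p => [|? ? ? u p /= ->]. Qed.

Lemma pmap_ext (O O' : Type) (h : gquiver R O) (h' : gquiver R O')
    (f0 : O -> O')
    (f g : forall x y d, h x y d -> h' (f0 x) (f0 y) d) :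
  (forall x y d u, f x y d u = g x y d u) ->
  forall x y (p : path h x y), pmap (f0 := f0) f p = pmap (f0 := f0) g p.
Proof. by move=> fg x y; elim=> [|? ? ? u p /= ->] //; rewrite fg. Qed.

Lemma is_strict_comp (O O' O'' : Type) (A : ainf R O) (B : ainf R O')
    (C : ainf R O'') (f0 : O -> O') (g0 : O' -> O'')
    (f : forall x y d, A x y d -> B (f0 x) (f0 y) d)
    (g : forall x y d, B x y d -> C (g0 x) (g0 y) d) :
  is_strict A B f0 f -> is_strict B C g0 g ->
  is_strict A C (fun x => g0 (f0 x)) (fun x y d u => g _ _ d (f x y d u)).
Proof.
move=> [fL fm] [gL gm]; split=> [x y d|x y p e].
  exact: linear_comp (fL x y d) (gL _ _ d).
by rewrite fm gm pmap_pmap.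
Qed.

(** A strict functor that kills the kernel of a strict surjection descends: a
    path in the target is the image of a path in the source, and the operations
    can be computed there. *)
Lemma strict_factor (O O' : Type) (A A' : ainf R O) (C : ainf R O')
    (E : forall x y d, A x y d -> A' x y d) (f0 : O -> O')
    (K : forall x y d, A x y d -> C (f0 x) (f0 y) d) :
  is_strict A A' id E -> is_strict A C f0 K ->
  (forall x y d (u : A' x y d), exists v, E x y d v = u) ->
  (forall x y d (v : A x y d), E x y d v = 0 -> K x y d v = 0) ->
  exists K' : forall x y d, A' x y d -> C (f0 x) (f0 y) d,
    is_strict A' C f0 K' /\ forall x y d v, K' x y d (E x y d v) = K x y d v.
Proof.
move=> [EL Em] [KL Km] Esurj kerE.
pose s x y d (u : A' x y d) : A x y d := sval (cid (Esurj x y d u)).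
have sE x y d u : E x y d (s x y d u) = u by rewrite /s; case: cid.
pose K' x y d (u : A' x y d) := K x y d (s x y d u).
have K'E x y d v : K' x y d (E x y d v) = K x y d v.
  apply/eqP; rewrite -subr_eq0 -(linear_sub (KL x y d)); apply/eqP/kerE.
  by rewrite (linear_sub (EL x y d)) sE subrr.
exists K'; split=> //; split=> [x y d a u v|x y p e].
  by rewrite -[u]sE -[v]sE -EL !K'E KL.
have pE : p = pmap (f0 := id) E (pmap (f0 := id) s p).
  by rewrite pmap_comp pmap_id.
rewrite {1}pE -Em K'E Km; congr (m _ e).
exact: (pmap_pmap (f0 := id)).
Qed.

Section Kernel.
Variables (O O' : Type) (A : ainf R O) (C : ainf R O') (f0 : O -> O').
Variable K : forall x y d, A x y d -> C (f0 x) (f0 y) d.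
Hypothesis K_strict : is_strict A C f0 K.

Section Hom.
Variables (x y : O) (d : int).
Definition strict_ker_pred : {pred A x y d} := fun u => `[< K u = 0 >].
Lemma strict_ker_closed : submod_closed strict_ker_pred.
Proof.
split=> [|a u v]; rewrite !unfold_in.
  by apply/asboolP/linear_zero/K_strict.1.
move=> /asboolP u0 /asboolP v0; apply/asboolP.
by rewrite K_strict.1 u0 v0 scaler0 addr0.
Qed.
HB.instance Definition _ :=
  GRing.isSubmodClosed.Build R (A x y d) strict_ker_pred strict_ker_closed.
End Hom.

Definition strict_ker_q : subquiver A :=
  SubQuiver (fun x y d => @strict_ker_pred x y d).

Lemma strict_kerP x y d (u : A x y d) :
  u \in strict_ker_q x y d <-> K u = 0.
Proof. by split=> [/asboolP|] // ?; apply/asboolP. Qed.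

Lemma strict_ker_m x y z w d (q : path A z w) (u : A y z d) (p : path A x y) e :
  u \in strict_ker_q y z d -> m (pcat q (pcons u p)) e \in strict_ker_q x w e.
Proof.
move=> /strict_kerP u0; apply/strict_kerP.
by rewrite K_strict.2 pmap_cat /= u0 m_zero.
Qed.

Lemma strict_ker_diff x y d (u : A x y d) :
  u \in strict_ker_q x y d -> m1 u \in strict_ker_q x y (d + 1).
Proof. exact: (@strict_ker_m _ _ _ _ _ (pnil y) u (pnil x)). Qed.

Definition strict_ker : ideal A :=
  @Ideal _ _ A (@SubDG _ _ (forget A) strict_ker_q strict_ker_diff)
    strict_ker_m.

(** The kernel is an ideal, so it contains the ideal generated by relations that
    it contains. *)
Lemma gen_ideal_ker (r : forall x y d, A x y d -> Prop) :
  (forall x y d (u : A x y d), r x y d u -> K u = 0) ->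
  forall x y d (u : A x y d), u \in gen_ideal r x y d -> K u = 0.
Proof.
move=> rK x y d u /asboolP /(_ strict_ker) uI.
by apply/strict_kerP/uI => *; apply/strict_kerP/rK.
Qed.
End Kernel.

End Strict.

(** * Lifting along a surjective quasi-isomorphism *)

(** The right lifting property of G against the inclusion of a cocycle z into
    the complex where z is made a boundary. Injectivity on cohomology gives w0
    with d w0 = z; then v - G w0 is a cocycle of B, and surjectivity on
    cohomology and on morphisms corrects w0 by a cocycle and a coboundary. *)
Lemma acyclic_fibration_lift (R : comPzRingType) (OC OB : Type)
    (C : suainf R OC) (B : suainf R OB) (G : sufunctor C B) :
  quasi_iso_on_homs G -> surjective_on_morphisms G ->
  forall x y d (z : C x y (d + 1)) (v : B (G x) (G y) d),
    m1 z = 0 -> fmor G z = m1 v ->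
    exists w : C x y d, m1 w = z /\ fmor G w = v.
Proof.
move=> Gqi Gsurj x y d z v z0 Gz; have [GL Gm] := fmor_strict G.
have G1 d' (u : C x y d') : fmor G (m1 u) = m1 (fmor G u) by apply: Gm.
have /coboundaryP[w0 w0E] : coboundary z.
  by apply: (Gqi x y (d + 1)).1 => //; apply/coboundaryP; exists v.
have [|c [c0 [u uE]]] := (Gqi x y d).2 (v - fmor G w0).
  by rewrite /cocycle (linear_sub (@m1_linear _ _ B _ _ _)) -G1 w0E Gz subrr.
have [u' u'E] := Gsurj _ _ _ u.
exists (w0 + (c - m (pcons u' (pnil x)) d)); split.
  have m1L := @m1_linear _ _ C x y d.
  rewrite (linear_add m1L) (linear_sub m1L).
  by rewrite w0E c0 /m1 m_mK subrr addr0.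
rewrite (linear_add (GL _ _ _)) (linear_sub (GL _ _ _)) Gm /= u'E uE.
by rewrite subKr addrC subrK.
Qed.

(** * The discrete category and the units *)

Section UnitFunctor.
Variables (R : comPzRingType) (O : Type).

Lemma disc_scalar_mem (x : O) (a : R) : (a : R^o) \in disc_sub R x x 0.
Proof. by apply/asboolP; left. Qed.

Definition disc_scalar (x : O) (a : R) : disc R O x x 0 :=
  exist _ (a : R^o) (disc_scalar_mem x a).

(** Spares every later proof the case analysis on the equalities between objects
    and between degrees that define disc. *)
Lemma disc_elim (P : forall x y d, disc R O x y d -> Prop) :
  (forall x y d, P x y d 0) -> (forall x a, P x x 0 (disc_scalar x a)) ->
  forall x y d r, P x y d r.
Proof.
move=> P0 P1 x y d r; have /asboolP[[exy ed]|r0] := valP r; last first.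
  by rewrite (_ : r = 0) //; apply: val_inj.
move: r; rewrite exy ed => r.
by rewrite (_ : r = disc_scalar y (\val r)) //; apply: val_inj.
Qed.

Variables (O' : Type) (C : suainf R O') (f0 : O -> O').

(** Sends r to r 1; the transports are along equalities decided classically, and
    proof irrelevance removes them on the diagonal. *)
Definition unit_mor x y d (r : disc R O x y d) : C (f0 x) (f0 y) d :=
  match pselect (x = y), pselect (0 = d) with
  | left exy, left ed =>
      eq_rect 0 (fun d => C (f0 x) (f0 y) d)
        (eq_rect x (fun y => C (f0 x) (f0 y) 0)
           ((\val r : R) *: one C (f0 x)) y exy) d ed
  | _, _ => 0
  end.

Lemma unit_mor_diag x (r : disc R O x x 0) :
  unit_mor r = (\val r : R) *: one C (f0 x).
Proof.
rewrite /unit_mor; case: pselect => // e; case: pselect => // e'.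
by rewrite (Prop_irrelevance e erefl) (Prop_irrelevance e' erefl).
Qed.

Lemma unit_mor_linear x y d : linear (@unit_mor x y d).
Proof.
have [[exy ed]|ne] := pselect (x = y /\ 0 = d).
  case: _ / ed; case: _ / exy => a u v; rewrite !unit_mor_diag.
  by rewrite scalerA -scalerDl.
have unit0 r : @unit_mor x y d r = 0.
  by rewrite /unit_mor; case: pselect => // ?; case: pselect => // ?; case: ne.
by move=> a u v; rewrite !unit0 scaler0 addr0.
Qed.

Lemma unit_mor_strict : is_strict (disc R O) C f0 unit_mor.
Proof.
split=> [|x y p e]; first exact: unit_mor_linear.
have unit0 x' y' d' : @unit_mor x' y' d' 0 = 0.
  exact/linear_zero/unit_mor_linear.
have disc0 x' y' (p' : path (disc R O) x' y') :
    disc_val p' e = 0 -> unit_mor (m p' e) = 0.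
  by move=> p0; rewrite (_ : m p' e = 0) //; apply: val_inj.
(* By multilinearity the first input may be taken to be a unit, and then the
   axioms of strict units settle every length but 2, for which both inputs may
   be taken to be units. *)
case: p => [|y1 y2 d2 r2 p]; first by rewrite disc0 // m_nil.
move: y1 y2 d2 r2 p; apply: disc_elim => [y1 y2 d2 p|y2 a p].
  rewrite disc0; last by rewrite /disc_val /= mul0r; case: ifP.
  rewrite /= unit0; symmetry; apply: (m_zero (pnil _)).
rewrite [pmap _ _]/= unit_mor_diag (m_scale _ (pnil _)) /=.
case: p => [|y0 y1 d1 r1 p].
  rewrite disc0 //.
  have [->|ne] := eqVneq e 1; last by rewrite m_deg ?scaler0 // mdeg1.
  by have [one0 _ _ _] := oneP C (f0 x); rewrite [m _ _]one0 scaler0.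
case: p r1 => [|x0 y0' d0 r0 p] r1; last first.
  have [_ _ _ onem] := oneP C (f0 y1).
  by rewrite disc0 // (onem _ _ (pnil _)) ?scaler0 // addn0.
move: x y1 d1 r1 a; apply: disc_elim => [x y1 d1 a|x b a].
  rewrite disc0; last by rewrite /disc_val /= mul0r mulr0; case: ifP.
  by rewrite /= unit0 (m_zero (pcons _ (pnil _))) scaler0.
rewrite [pmap _ _]/= unit_mor_diag (m_scale _ (pcons _ (pnil _))) /=.
have [->|ne] := eqVneq e 0; last first.
  rewrite disc0; last by rewrite /disc_val /= (negbTE ne).
  by rewrite m_deg ?scaler0.
have [_ oner _ _] := oneP C (f0 x).
by rewrite unit_mor_diag oner scalerA /= /disc_val /= mulr1.
Qed.
End UnitFunctor.

(** * Lifts on the steps of the filtration *)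

Section Subobjects.
Variables (R : comPzRingType) (O : Type).

Definition sub_elt (h : gquiver R O) (S : subquiver h) x y d (u : h x y d)
  (Su : u \in S x y d) : gsub S x y d := exist _ u Su.

Lemma gpi_eq0 (h : gquiver R O) (S : subquiver h) x y d (u : h x y d) :
  gpi S u = 0 <-> u \in S x y d.
Proof.
rewrite -[X in X \in _]subr0 -(qpi_eq (S x y d)) /gpi.
by rewrite (linear_zero (@qpi_linear _ _ (S x y d))).
Qed.

Lemma sval_strict (A : ainf R O) (S : subainf A) :
  is_strict (asub S) A id (sval1 S).
Proof. by split=> // x y d; apply: submod_val_linear. Qed.

End Subobjects.

Section Lifting.
Variables (R : comPzRingType) (OA OB OC : Type).
Variables (A : suainf R OA) (B : suainf R OB) (C : suainf R OC).
Variables (G : sufunctor C B) (f0 : OA -> OC).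
(* The object map of F is x |-> G (f0 x) by definition, so that G (H u) and
   F u have the same type for every H over f0. *)
Variable F1 : forall x y d, A x y d -> B (G (f0 x)) (G (f0 y)) d.
Hypothesis F_strict : is_strict A B (fun x => G (f0 x)) F1.
Hypothesis F_one : forall x, F1 (one A x) = one B (G (f0 x)).

Definition partial_lift (S : subsuainf A)
    (H : forall x y d, asub S x y d -> C (f0 x) (f0 y) d) : Prop :=
  [/\ is_strict (asub S) C f0 H,
      forall x, H x x 0 (sub_one S x) = one C (f0 x)
    & forall x y d (u : asub S x y d), fmor G (H x y d u) = F1 (\val u)].

Section Base.
Variables (S : subsuainf A) (g0 : OA -> OA).
Variable D : forall x y d, disc R OA x y d -> A (g0 x) (g0 y) d.
Hypothesis D_strict : is_strict (disc R OA) A g0 D.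
Hypothesis g0_bij : bijective g0.
Hypothesis D_inj : forall x y d, injective (@D x y d).
Hypothesis D_im : forall x y d (f : A (g0 x) (g0 y) d),
  f \in S (g0 x) (g0 y) d <-> exists r, D r = f.

(** D is only assumed to be strict. Since 1_x is in its image, 1_x = r e with
    e = D 1, and e = m(e, 1_x) = r m(e, e) = r e = 1_x. *)
Lemma disc_image_scalar x a : D (disc_scalar x a) = a *: one A (g0 x).
Proof.
have DZ b c : D (disc_scalar x (b * c)) = b *: D (disc_scalar x c).
  by rewrite -(linear_scale (D_strict.1 x x 0)); congr (D _); apply: val_inj.
rewrite -[a]mulr1 DZ mulr1; congr (a *: _).
have [[r /= rS] rE] : exists r, D r = one A (g0 x).
  by apply/D_im/subsu_one.
have oneE : one A (g0 x) = r *: D (disc_scalar x 1).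
  by rewrite -DZ mulr1 -rE; congr (D _); apply: val_inj.
set e := D _ in oneE *.
have ee : m (pcons e (pcons e (pnil (g0 x)))) 0 = e.
  pose u2 : path (disc R OA) x x :=
    pcons (disc_scalar x 1) (pcons (disc_scalar x 1) (pnil x)).
  rewrite -[X in m X _]/(pmap (f0 := g0) D u2) -D_strict.2.
  congr (D _); apply: val_inj.
  by rewrite /= /disc_val /= !mulr1.
have [_ oner _ _] := oneP A (g0 x).
rewrite -{1}[e]oner oneE (m_scale _ (pcons e (pnil _)) _ (pnil _)) /=.
by rewrite ee.
Qed.

Lemma unit_mem x y d (r : disc R OA x y d) :
  unit_mor A id r \in S x y d.
Proof.
move: x y d r; apply: disc_elim => [x y d|x a].
  by rewrite (linear_zero (@unit_mor_linear _ _ _ A id x y d)) rpred0.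
by rewrite unit_mor_diag rpredZ // subsu_one.
Qed.

(** [S] is freely spanned by the units, so that [unit_mor C f0] descends to it
    along [unit_mor A id]. *)
Lemma partial_lift_disc : exists H, @partial_lift S H.
Proof.
pose E x y d (r : disc R OA x y d) : asub S x y d := sub_elt (unit_mem r).
have [idL idm] := unit_mor_strict A (id : OA -> OA).
have E_strict : is_strict (disc R OA) (asub S) id E.
  split=> [x y d|x y p e]; first exact: (linear_corestrict _ (idL x y d)).
  apply: val_inj; rewrite /= idm; congr (m _ e).
  by rewrite (pmap_pmap (f0 := id) (g0 := id)).
have [gi gK giK] := g0_bij.
have E_surj x y d (u : asub S x y d) : exists r, E x y d r = u.
  have g0_surj z : exists z', g0 z' = z by exists (gi z).
  move: (g0_surj x) (g0_surj y) u => [x' <-] [y' <-] [u Su] {x y}.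
  have /D_im[r rE] := Su.
  suff [r' r'E] : exists r', unit_mor A id r' = u by exists r'; apply: val_inj.
  rewrite -{u Su}rE; move: x' y' d r; apply: disc_elim => [x y d|x a].
    exists 0; rewrite (linear_zero (idL _ _ _)).
    by rewrite (linear_zero (D_strict.1 _ _ _)).
  by exists (disc_scalar (g0 x) a); rewrite unit_mor_diag disc_image_scalar.
have one_free x a : a *: one A x = 0 -> a = 0.
  rewrite -(giK x) -disc_image_scalar.
  rewrite -(linear_zero (D_strict.1 (gi x) (gi x) 0)).
  by move=> /D_inj/(congr1 (\val)).
have E0 x y d (r : disc R OA x y d) : E x y d r = 0 -> unit_mor C f0 r = 0.
  move=> /(congr1 (\val)) /=; move: x y d r; apply: disc_elim => [x y d _|x a].
    exact: linear_zero (@unit_mor_linear _ _ _ C f0 x y d).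
  by rewrite !unit_mor_diag => /one_free /= ->; rewrite scale0r.
have [H [H_strict HE]] :=
  strict_factor E_strict (unit_mor_strict C f0) E_surj E0.
have GE x y d (r : disc R OA x y d) :
    fmor G (unit_mor C f0 r) = F1 (unit_mor A id r).
  have [GL _] := fmor_strict G; have [FL _] := F_strict.
  move: x y d r; apply: disc_elim => [x y d|x a].
    rewrite !(linear_zero (@unit_mor_linear _ _ _ _ _ x y d)).
    by rewrite (linear_zero (GL _ _ _)) (linear_zero (FL _ _ _)).
  rewrite !unit_mor_diag (linear_scale (GL _ _ _)) (linear_scale (FL _ _ _)).
  by rewrite fmor_one F_one.
exists H; split=> // [x|x y d u].
  rewrite (_ : sub_one S x = E x x 0 (disc_scalar x 1)).
    by rewrite HE unit_mor_diag scale1r.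
  by apply: val_inj; rewrite /= unit_mor_diag scale1r.
by have [r <-] := E_surj x y d u; rewrite HE GE.
Qed.
End Base.

Section Extension.
Hypothesis G_qi : quasi_iso_on_homs G.
Hypothesis G_surj : surjective_on_morphisms G.

Section DGExtension.
Variables (S : subsuainf A) (Q : subdg (forget A)) (SQ : subq_le S Q).
Local Notation T := (restr Q (subainf_dg S)).
Hypothesis quot_diff0 : forall x y d (c : dgquot T x y d), diff c = 0.
Hypothesis quot_free : forall x y d, free_module (dgquot T x y d).
Variable H : forall x y d, asub S x y d -> C (f0 x) (f0 y) d.
Hypothesis H_lift : partial_lift H.

Lemma diff_in_sub x y d (q : dgsub Q x y d) : \val (diff q) \in S x y (d + 1).
Proof.
by apply/(gpi_eq0 T (diff q)); rewrite -quot_diff_pi; apply: quot_diff0.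
Qed.

(** [sigma] is a section of the quotient map and [omega] a lift of F on its
    image whose differential is the one prescribed by H. The choices are made on
    a basis, where [acyclic_fibration_lift] provides them, and the identities
    are between linear maps out of the free quotient. *)
Lemma quotient_lift x y d :
  exists (sigma : dgquot T x y d -> dgsub Q x y d)
         (omega : dgquot T x y d -> C (f0 x) (f0 y) d),
    [/\ linear sigma, linear omega, forall c, gpi T (sigma c) = c,
        forall c, m1 (omega c) = H (sub_elt (diff_in_sub (sigma c)))
      & forall c, fmor G (omega c) = F1 (\val (sigma c))].
Proof.
have [[HL Hm] _ GH] := H_lift.
have [GL Gm] := fmor_strict G; have [FL Fm] := F_strict.
have [I [b [ext uniq]]] := free_module_ext (@quot_free x y d).
have [sigma [sL sb]] := ext (dgsub Q x y d) (fun i => grepr (b i)).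
have w_ex i : exists w : C (f0 x) (f0 y) d,
    m1 w = H (sub_elt (diff_in_sub (sigma (b i)))) /\
    fmor G w = F1 (\val (sigma (b i))).
  apply: acyclic_fibration_lift => //.
    rewrite -[LHS](Hm _ _ (pcons _ (pnil _))).
    rewrite (_ : m _ _ = 0) ?(linear_zero (HL _ _ _)) //.
    exact/val_inj/(@diffK _ _ (forget A)).
  by rewrite GH /=; apply: (Fm _ _ (pcons _ (pnil _))).
have [w wE] := choice w_ex.
have [omega [oL ob]] := ext _ w.
have HsL : linear (fun c => H (sub_elt (diff_in_sub (sigma c)))).
  apply: (linear_comp (f := fun c => sub_elt (diff_in_sub (sigma c))))
    (HL _ _ _).
  apply: (linear_corestrict (f := fun c => \val (diff (sigma c)))).
  apply: (linear_comp (f := fun c => diff (sigma c)))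
    (@submod_val_linear _ _ (Q x y (d + 1))).
  exact: linear_comp sL (@diff_linear _ _ (dgsub Q) _ _ _).
exists sigma, omega; split=> //; apply: uniq.
- by apply: linear_comp sL _; apply: qpi_linear.
- by [].
- by move=> i; rewrite sb; apply: qreprK.
- exact: linear_comp oL (@m1_linear _ _ C _ _ _).
- exact: HsL.
- by move=> i; rewrite ob (wE i).1.
- exact: linear_comp oL (GL _ _ _).
- apply: (linear_comp (f := fun c => \val (sigma c))) (FL x y d).
  exact: linear_comp sL (@submod_val_linear _ _ (Q x y d)).
- by move=> i; rewrite ob (wE i).2.
Qed.

(** On q, the extension is H (q - sigma [q]) + omega [q]. *)
Lemma dg_extension :
  exists phi : forall x y d, dgsub Q x y d -> C (f0 x) (f0 y) d,
  [/\ is_dgmap (dgsub Q) (forget C) f0 phi,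
      forall x y d (u : asub S x y d), phi x y d (gincl SQ u) = H u
    & forall x y d (q : dgsub Q x y d), fmor G (phi x y d q) = F1 (\val q)].
Proof.
have [[HL Hm] _ GH] := H_lift.
have [GL Gm] := fmor_strict G; have [FL Fm] := F_strict.
pose sg x y d := sval (cid (quotient_lift x y d)).
pose om x y d := sval (cid (svalP (cid (quotient_lift x y d)))).
have lifts x y d : [/\ linear (sg x y d), linear (om x y d),
    forall c, gpi T (sg x y d c) = c,
    forall c, m1 (om x y d c) = H (sub_elt (diff_in_sub (sg x y d c)))
  & forall c, fmor G (om x y d c) = F1 (\val (sg x y d c))].
  exact: svalP (cid (svalP (cid (quotient_lift x y d)))).
have piL x y d : linear (fun q : dgsub Q x y d => gpi T q) by apply: qpi_linear.
have rS x y d (q : dgsub Q x y d) : \val (q - sg x y d (gpi T q)) \in S x y d.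
  have [_ _ sK _ _] := lifts x y d; apply/(gpi_eq0 T (q - sg x y d (gpi T q))).
  by rewrite (linear_sub (piL x y d)) sK subrr.
pose phi x y d q := H (sub_elt (rS x y d q)) + om x y d (gpi T q).
have pi0 x y d (q : dgsub Q x y d) : \val q \in S x y d -> gpi T q = 0.
  by move=> Sq; apply/(gpi_eq0 T q).
have phiS x y d (q : dgsub Q x y d) (Sq : \val q \in S x y d) :
    phi x y d q = H (sub_elt Sq).
  have [sL oL _ _ _] := lifts x y d.
  rewrite /phi [X in om _ _ _ X]pi0 // (linear_zero oL) addr0; congr H.
  by apply: val_inj; rewrite /= pi0 // (linear_zero sL) subr0.
exists phi; split.
- split=> [x y d|x y d q].
    have [sL oL _ _ _] := lifts x y d.
    apply: linear_addf; last exact: linear_comp (piL x y d) oL.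
    apply: (linear_comp (f := fun q => sub_elt (rS x y d q))) (HL _ _ _).
    apply: (linear_corestrict (f := fun q => \val (q - sg x y d (gpi T q)))).
    apply: (linear_comp (f := fun q => q - sg x y d (gpi T q)))
      (@submod_val_linear _ _ (Q x y d)).
    by apply: linear_subf => //; apply: linear_comp (piL x y d) sL.
  have [_ _ _ omE _] := lifts x y d.
  rewrite (phiS _ _ _ _ (diff_in_sub q)) -[RHS]/(m1 (phi x y d q)).
  rewrite (linear_add (@m1_linear _ _ C _ _ _)) omE.
  have Hm1 u : m1 (H u) = H (m1 u : asub S x y (d + 1)).
    by symmetry; apply: (Hm _ _ (pcons _ (pnil _))).
  rewrite Hm1 -(linear_add (HL _ _ _)); congr H; apply: val_inj.
  set s := sg x y d _.
  rewrite linearD /= -[RHS]/(m1 (\val (q - s)) + m1 (\val s)).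
  rewrite -(linear_add (@m1_linear _ _ A _ _ _)); congr m1.
  by rewrite -(linear_add (@submod_val_linear _ _ (Q x y d))) subrK.
- move=> x y d u; rewrite (phiS x y d (gincl SQ u) (valP u)).
  by congr H; apply: val_inj.
move=> x y d q; have [sL oL _ _ GE] := lifts x y d.
rewrite /phi (linear_add (GL _ _ _)) GH GE -(linear_add (FL _ _ _)).
congr F1; apply: etrans (linear_add (@submod_val_linear _ _ (Q x y d)) _ _) _.
by rewrite subrK.
Qed.

(** [phi] extends to [K] on the free A_oo-category, and [K] descends to [S']
    along the presentation [E] of [S'] as a quotient of it. *)
Lemma attachment_lift (S' : subsuainf A) :
  @free_attachment _ _ A S S' Q SQ ->
  exists H' : forall x y d, asub S' x y d -> C (f0 x) (f0 y) d,
    partial_lift H' /\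
    forall x y d (u : asub S x y d) (u' : asub S' x y d),
      \val u' = \val u -> H' x y d u' = H u.
Proof.
move=> [Fr [eta [[eta_dg Fr_univ] [Phi [Phi_strict Phi_bij Phi_eta]]]]].
set I := gen_ideal _ in Phi Phi_strict Phi_bij Phi_eta.
have [phi [phi_dg phiH phiF]] := dg_extension.
have [H_strict H1 _] := H_lift.
have [K [[K_strict Keta] _]] := Fr_univ _ _ _ _ phi_dg.
pose i x y d (u : asub S x y d) := eta x y d (gincl SQ u).
have Ki x y d (u : asub S x y d) : K x y d (i x y d u) = H u.
  by rewrite Keta phiH.
have Kpath x y (p : path (asub S) x y) :
    pmap K (pmap (f0 := id) i p) = pmap H p.
  by rewrite (pmap_pmap (f0 := id)); exact: (pmap_ext Ki p).
have [KL Km] := K_strict.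
have K_rel x y d (u : Fr x y d) :
    attach_rel i (sub_one S) u -> K x y d u = 0.
  case=> {x y d u} [x y p e _|x y d u|x y d u|x y z q p e pq].
  - by rewrite (linear_sub (KL _ _ _)) Km Kpath Ki H_strict.2 subrr.
  - have [_ oner _ _] := oneP C (f0 x).
    by rewrite (linear_sub (KL _ _ _)) Km /= Ki H1 oner subrr.
  - have [_ _ onel _] := oneP C (f0 y).
    rewrite (linear_sub (KL _ _ _)) (linear_scale (KL _ _ _)) Km /= Ki H1.
    by rewrite onel subrr.
  have [_ _ _ onem] := oneP C (f0 y).
  by rewrite Km pmap_cat /= Ki H1 onem // !plen_pmap.
have pi_strict : is_strict Fr (aquot I) id (@gpi _ _ _ I).
  by split=> [x y d|x y p e]; [apply: qpi_linear | apply: quot_m_pi].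
pose E x y d (f : Fr x y d) : asub S' x y d := Phi x y d (gpi I f).
have E_strict : is_strict Fr (asub S') id E.
  exact: is_strict_comp pi_strict Phi_strict.
have E_surj x y d (u : asub S' x y d) : exists v, E x y d v = u.
  have [Psi _ PhiK] := Phi_bij x y d.
  by exists (grepr (Psi u)); rewrite /E /gpi qreprK.
have E_ker x y d (v : Fr x y d) : E x y d v = 0 -> K x y d v = 0.
  have [PhiL _] := Phi_strict; have [Psi PhiK _] := Phi_bij x y d.
  rewrite -(linear_zero (PhiL x y d)) => /(can_inj PhiK)/gpi_eq0 vI.
  exact: (gen_ideal_ker K_strict K_rel vI).
have [H' [H'_strict H'E]] := strict_factor E_strict K_strict E_surj E_ker.
have H'S x y d (u : asub S x y d) (u' : asub S' x y d) :
    \val u' = \val u -> H' x y d u' = H u.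
  move=> uu'; rewrite -Ki -H'E; congr H'; apply: val_inj.
  by rewrite uu' Phi_eta.
exists H'; split=> //; split=> // [x|x y d u].
  by rewrite -H1; apply: H'S.
have [v <-] := E_surj x y d u; rewrite H'E {u}.
(* Both composites to B are strict and restrict to F on Q, so that they agree by
   the uniqueness part of the universal property. *)
pose GK x y d (v : Fr x y d) := fmor G (K x y d v).
pose FE x y d (v : Fr x y d) := F1 (\val (E x y d v)).
suff: GK = FE by move=> /(congr1 (fun f => f x y d v)).
have FQ_dg : is_dgmap (dgsub Q) (forget B) (fun x => G (f0 x))
    (fun x y d q => F1 (\val q)).
  have [FL Fm] := F_strict; split=> [x' y' d'|x' y' d' q].
    by apply: (linear_comp (f := \val)) (FL x' y' d'); apply: submod_val_linear.
  exact: (Fm _ _ (pcons _ (pnil _))).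
have [U [_ U_uniq]] := Fr_univ _ _ _ _ FQ_dg.
rewrite -(U_uniq GK); first apply: U_uniq.
  split; last by move=> *; rewrite /FE Phi_eta.
  exact: is_strict_comp (is_strict_comp E_strict (sval_strict S')) F_strict.
split; first exact: is_strict_comp K_strict (fmor_strict G).
by move=> *; rewrite /GK Keta phiF.
Qed.
End DGExtension.

(** * The union of the filtration *)

Section Union.
Variables (S : nat -> subsuainf A) (Q : nat -> subdg (forget A)).
Hypothesis SQ_filt : semifree_filtration S Q.

Lemma filtration_le n n' : (n <= n')%N -> subq_le (S n) (S n').
Proof.
elim: n' => [|n' IH]; first by rewrite leqn0 => /eqP ->.
rewrite leq_eqVlt ltnS => /predU1P[-> //|/IH nn'] x y d u Su.
exact/(sf_QS SQ_filt)/(sf_SQ SQ_filt)/nn'.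
Qed.

Lemma partial_lift_chain :
  exists H : forall n x y d, asub (S n) x y d -> C (f0 x) (f0 y) d,
    (forall n, partial_lift (H n)) /\
    forall n x y d (u : asub (S n) x y d) (u' : asub (S n.+1) x y d),
      \val u' = \val u -> H n.+1 x y d u' = H n x y d u.
Proof.
pose lift n := {H : forall x y d, asub (S n) x y d -> C (f0 x) (f0 y) d
                  | partial_lift H}.
pose extends n (H : lift n) (H' : lift n.+1) :=
  forall x y d (u : asub (S n) x y d) (u' : asub (S n.+1) x y d),
    \val u' = \val u -> sval H' x y d u' = sval H x y d u.
have base : exists H, @partial_lift (S 0) H.
  have [g0 [D [D_strict g0_bij D_inj D_im]]] := sf_disc SQ_filt.
  exact: partial_lift_disc D_strict g0_bij D_inj D_im.
have step n (H : lift n) : exists H' : lift n.+1, extends n H H'.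
  have [H' [H'_lift ext]] := attachment_lift (sf_quot_diff SQ_filt (n := n))
    (sf_quot_free SQ_filt n) (svalP H) (sf_attach SQ_filt n).
  by exists (exist _ H' H'_lift).
pose Hs := nat_rect lift (cid base) (fun n H => sval (cid (step n H))).
exists (fun n => sval (Hs n)); split=> n; first exact: svalP (Hs n).
exact: svalP (cid (step n (Hs n))).
Qed.

(** A path has finitely many entries, and the filtration is increasing. *)
Lemma path_in_filtration x y (p : path A x y) :
  exists n (p' : path (asub (S n)) x y), p = pmap (f0 := id) (sval1 (S n)) p'.
Proof.
elim: p => [|y' z d u p [n [p' ->]]]; first by exists 0, (pnil x).
have [n' Su] := sf_union SQ_filt u.
pose N := maxn n n'.
have nN : subq_le (S n) (S N) by apply/filtration_le/leq_maxl.
have n'N : subq_le (S n') (S N) by apply/filtration_le/leq_maxr.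
exists N, (pcons (sub_elt (n'N _ _ _ _ Su)) (pmap (f0 := id) (gincl nN) p')).
by rewrite /= pmap_comp.
Qed.

Lemma filtered_lift :
  exists Ft : forall x y d, A x y d -> C (f0 x) (f0 y) d,
  [/\ is_strict A C f0 Ft, forall x, Ft x x 0 (one A x) = one C (f0 x)
    & forall x y d (u : A x y d), fmor G (Ft x y d u) = F1 u].
Proof.
have [H [H_lift H_ext]] := partial_lift_chain.
have H_le n k x y d (u : asub (S n) x y d) (u' : asub (S (k + n)) x y d) :
    \val u' = \val u -> H (k + n)%N x y d u' = H n x y d u.
  elim: k u' => [|k IH] u' uu'; first by congr H; apply: val_inj.
  have Su : \val u \in S (k + n) x y d.
    exact: (filtration_le (leq_addl k n)) (valP u).
  by rewrite -(IH (sub_elt Su)) //; apply: H_ext.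
have H_eq n n' x y d (u : asub (S n) x y d) (u' : asub (S n') x y d) :
    \val u = \val u' -> H n x y d u = H n' x y d u'.
  wlog le_nn' : n n' u u' / (n <= n')%N => [th uu'|].
    by case/orP: (leq_total n n') => /th E; [apply: E | symmetry; apply: E].
  by rewrite -(subnK le_nn') in u' * => uu'; symmetry; apply: H_le.
have mem x y d (u : A x y d) := svalP (cid (sf_union SQ_filt u)).
pose Ft x y d (u : A x y d) := H _ x y d (sub_elt (mem x y d u)).
have FtE n x y d (u : asub (S n) x y d) : Ft x y d (\val u) = H n x y d u.
  exact: H_eq.
exists Ft; split=> [|x|x y d u]; last first.
- by have [_ _ ->] := H_lift (sval (cid (sf_union SQ_filt u))).
- by have [_ H1 _] := H_lift 0; rewrite -H1 -FtE.
split=> [x y d a u v|x y p e].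
  have [n Su] := sf_union SQ_filt u; have [n' Sv] := sf_union SQ_filt v.
  pose u' := sub_elt (filtration_le (leq_maxl n n') Su).
  pose v' := sub_elt (filtration_le (leq_maxr n n') Sv).
  have [[HL _] _ _] := H_lift (maxn n n').
  rewrite -[u]/(sval1 _ _ _ _ u') -[v]/(sval1 _ _ _ _ v').
  by rewrite -(sval_strict _).1 !FtE HL.
have [n [p' ->]] := path_in_filtration p.
have [[_ Hm] _ _] := H_lift n.
rewrite -(sval_strict (S n)).2 FtE Hm (pmap_pmap (f0 := id)).
by congr (m _ e); symmetry; apply: pmap_ext => *; apply: FtE.
Qed.
End Union.
End Extension.
End Lifting.

(* The object-level hypothesis (every F a is in the image of G on objects) is
   implied by the conclusion, and does not follow from the essential
   surjectivity of H^0(G). *)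
Theorem lemmaD (R : comPzRingType) (OA OB OC : Type)
    (Asf : suainf R OA) (B : suainf R OB) (C : suainf R OC)
    (F : sufunctor Asf B) (G : sufunctor C B) :
  semifree Asf ->
  quasi_equivalence G ->
  surjective_on_morphisms G ->
  (forall a : OA, exists c : OC, G c = F a) ->
  exists Ft : sufunctor Asf C, sucomp G Ft = F.
Proof.
move=> [S [Q SQ_filt]] [G_qi _] G_surj /choice[f0 Gf0].
case: F Gf0 => F0 F1 F_strict F_one /= Gf0.
have F0E : F0 = (fun a => G (f0 a)) by apply: funext => a; rewrite Gf0.
(* F0 is now a variable, so that a |-> G (f0 a) can replace it in the type
   of F1. *)
subst F0.
have [Ft [Ft_strict Ft_one GFt]] :=
  filtered_lift F_strict F_one G_qi G_surj SQ_filt.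
exists (SUFunctor Ft_strict Ft_one).
have compE : comp_mor G (SUFunctor Ft_strict Ft_one) = F1.
  by do 4![apply: functional_extensionality_dep => ?]; apply: GFt.
rewrite /sucomp; move: (comp_strict _ _) (comp_one _ _).
rewrite compE => s o; congr (SUFunctor _ _); exact: Prop_irrelevance.
Qed.
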